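(* Let $K_4$ denote the complete $3$-graph on $4$ vertices and $K_4^-$ the $3$-graph on $4$ vertices with exactly $3$ edges. Then \[\pi_{K_4^-}(\{K_4\}) = \frac{16}{27}.\]
   Context: A $3$-graph is a pair $G=(V,E)$ with $E$ a set of $3$-element subsets of $V$. For a $3$-graph $H$ on $h$ vertices and a $3$-graph $G$ on $n\ge h$ vertices, $e_H(G)$ is the number of $h$-element subsets of $V(G)$ that induce a subgraph of $G$ isomorphic to $H$. For a family $\mathcal{F}$ of $3$-graphs, $G$ is $\mathcal{F}$-free if it contains no member of $\mathcal{F}$ as a (not necessarily induced) subgraph. Let $\mathrm{ex}_H(n,\mathcal{F})$ be the maximum of $e_H(G)$ over all $\mathcal{F}$-free $3$-graphs $G$ on $n$ vertices, and define the Turán $H$-density $\pi_H(\mathcal{F})=\lim_{n\to\infty}\mathrm{ex}_H(n,\mathcal{F})/\binom{n}{h}$ (this limit exists). *)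

(* Defs.v *)
From HB Require Import structures.
From mathcomp Require Import all_boot all_order all_algebra.
From mathcomp Require Import all_classical all_reals all_analysis.

Set Implicit Arguments.
Unset Strict Implicit.
Unset Printing Implicit Defensive.

Import Order.TTheory GRing.Theory Num.Theory.
Import numFieldNormedType.Exports.

Record graph3 (V : finType) := Graph3 {
  edges :> {set {set V}};
  _ : [forall e in edges, #|e| == 3] }.

HB.instance Definition _ (V : finType) := [isSub for @edges V].
HB.instance Definition _ (V : finType) := [Finite of graph3 V by <:].

Definition isomorphic (V W : finType) (G : graph3 V) (H : graph3 W) : Prop :=
  exists f : V -> W,
    bijective f /\ forall e : {set V}, (e \in edges G) = (f @: e \in edges H).

Definition contains (V W : finType) (G : graph3 V) (H : graph3 W) : Prop :=
  exists f : W -> V,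
    injective f /\ forall e : {set W}, e \in edges H -> f @: e \in edges G.

Section Induced.
Variables (V : finType) (G : graph3 V) (A : {set V}).

Definition induced_edges : {set {set {x : V | x \in A}}} :=
  [set e : {set {x : V | x \in A}} | val @: e \in edges G]%SET.

Lemma induced_edges3 : [forall e in induced_edges, #|e| == 3].
Proof.
apply/forall_inP => e; rewrite inE => eG.
by case: G eG => E /= /forall_inP E3 /E3; rewrite card_imset //; exact: val_inj.
Qed.

Definition induced : graph3 {x : V | x \in A} := Graph3 induced_edges3.

End Induced.

Definition count_induced (V W : finType) (H : graph3 W) (G : graph3 V) : nat :=
  #|[set A : {set V} | (#|A| == #|W|) && `[< isomorphic (induced G A) H >]]%SET|.

(* Up to isomorphism every finite 3-graph has vertex type 'I_k. *)
Definition family3 := set {k : nat & graph3 'I_k}.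

Definition single3 (k : nat) (H : graph3 'I_k) : family3 :=
  [set existT (fun k => graph3 'I_k) k H]%classic.

Definition free (F : family3) (V : finType) (G : graph3 V) : Prop :=
  forall (k : nat) (H : graph3 'I_k),
    F (existT (fun k => graph3 'I_k) k H) -> ~ contains G H.

Definition turan_ex (W : finType) (H : graph3 W) (n : nat) (F : family3) : nat :=
  \max_(G : graph3 'I_n | `[< free F G >]) count_induced H G.

Local Open Scope ring_scope.
Local Open Scope classical_set_scope.

(* The terms with n < #|W| are 0 / 0 = 0 and do not affect the limit.
   The value of lim on a divergent real sequence is 0, so an equation
   turan_density R H F = l with l != 0 entails convergence to l. *)
Definition turan_density (R : realType) (W : finType) (H : graph3 W)
    (F : family3) : R :=
  lim ((fun n : nat => (turan_ex H n F)%:R / ('C(n, #|W|))%:R : R) @ \oo).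

Local Close Scope classical_set_scope.
Local Close Scope ring_scope.

Lemma K4_edges3 :
  [forall e in [set e : {set 'I_4} | #|e| == 3]%SET, #|e| == 3].
Proof. by apply/forall_inP => e; rewrite inE. Qed.

Definition K4 : graph3 'I_4 := Graph3 K4_edges3.

(* K4 with the edge avoiding vertex 0 removed. *)
Lemma K4minus_edges3 :
  [forall e in (edges K4 :\ [set~ ord0])%SET, #|e| == 3].
Proof. by apply/forall_inP => e; rewrite !inE => /andP[]. Qed.

Definition K4minus : graph3 'I_4 := Graph3 K4minus_edges3.

Lemma card_K4minus : #|edges K4minus| = 3.
Proof.
have := cardsD1 [set~ ord0]%SET (edges K4).
by rewrite inE cardsC1 card_draws card_ord => -[].
Qed.

(* Main.v *)
From Stdlib Require Import ZArith.
Require Import Defs.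
From mathcomp Require Import all_boot all_order all_fingroup all_algebra.
From mathcomp Require Import boolp.
From mathcomp Require Import ssrZ zify ring lra.

(** Upper bound: a flag algebra computation on six vertices. For a symmetric
    ternary relation [e] without K4 on a finite set [V], sum over all of [V^6]
    (repetitions allowed: a degenerate triple is never an edge, so no error term
    appears). For three types -- two edges on four vertices (cherry), K4^-
    (apex), and two vertices (pair) -- a positive semidefinite quadratic form in
    the flag counts has a nonnegative sum over [V^6]. The forms below are chosen
    such that, after symmetrisation over the 720 relabellings, the constant 16/27
    minus the K4^- density minus the forms is nonnegative at every K4-free
    3-graph on six vertices; this is checked by extending each of the 23 K4-free
    3-graphs on five vertices in all possible ways.

    Lower bound: Turan's construction, with parts A, B, C given by residues
    modulo 3 and edges AAB, BBC, CCA, ABC. *)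

Set Implicit Arguments.
Unset Strict Implicit.
Unset Printing Implicit Defensive.

Import Order.TTheory GRing.Theory Num.Theory.

Local Delimit Scope Z_scope with Z.

(** * Quadratic forms and flags *)

Definition squares := seq (Z * seq Z).

(* An element (w, l) stands for the square of the linear form l with weight w.
   The weights and forms come from an exact rounding of a solution of the
   semidefinite program, on the face orthogonal to Turan's construction; all
   weights are scaled by 25194240. *)
Definition cherry_squares : squares :=
  [:: (228096, [:: 3; 12; 7; 15; 14; -18]);
      (110160, [:: 4; 0; -5; -16; -12; 12]);
      (1223424, [:: -3; 0; 0; 3; 1; 0]);
      (6495552, [:: 0; 0; 1; 0; 0; 0]);
      (33048, [:: 0; 0; -1; 0; 12; 0])]%Z.

Definition apex_squares : squares :=
  [:: (649728, [:: -1; -4; -3; -5; 6; 6; 6; -3]);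
      (49896, [:: 0; 0; 0; -5; 12; 7; 0; -7]);
      (77844, [:: -1; 12; 0; -1; -6; 6; 0; -6]);
      (50544, [:: 12; 0; 0; 1; -4; -4; 0; 4]);
      (4920912, [:: 0; 0; 0; 0; 0; -1; 0; 1]);
      (14904, [:: 0; 0; 0; 12; 0; -5; 0; 5])]%Z.

Definition pair_squares : squares :=
  [:: (16602894, [:: 0; 0; -1; 0; 0; 0; 1; 0]);
      (37584, [:: -12; -7; 28; -19; -22; 12; -8; 4]);
      (27216, [:: 0; 0; 11; 12; 0; 0; -11; 0]);
      (14509, [:: -24; 0; 21; -17; 0; 0; 3; 12]);
      (16029, [:: 8; 12; -1; 10; 0; 0; -7; -4]);
      (8424, [:: 4; -3; -20; 4; 12; 0; 64; -14])]%Z.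

(** Entry (i, j) of the Gram matrix of the form. Since [nth] reads a missing coordinate as 0, flags
    beyond the length of the lists contribute nothing. *)
Definition form (Q : squares) (i j : nat) : Z :=
  foldr (fun s z => s.1 * (nth 0 s.2 i * nth 0 s.2 j) + z)%Z 0%Z Q.

Definition form_table (Q : squares) : seq (seq Z) :=
  [seq [seq form Q i j | j <- iota 0 9] | i <- iota 0 9].

Definition cherry_table := Eval vm_compute in form_table cherry_squares.
Definition apex_table := Eval vm_compute in form_table apex_squares.
Definition pair_table := Eval vm_compute in form_table pair_squares.

Lemma form_tableE Q i j : i < 9 -> j < 9 ->
  nth 0%Z (nth [::] (form_table Q) i) j = form Q i j.
Proof.
move=> i9 j9; rewrite (nth_map 0) ?size_iota // (nth_map 0) ?size_iota //.
by rewrite !nth_iota.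
Qed.

Lemma cherry_tableE i j : i < 9 -> j < 9 ->
  nth 0%Z (nth [::] cherry_table i) j = form cherry_squares i j.
Proof. exact: (@form_tableE cherry_squares). Qed.

Lemma apex_tableE i j : i < 9 -> j < 9 ->
  nth 0%Z (nth [::] apex_table i) j = form apex_squares i j.
Proof. exact: (@form_tableE apex_squares). Qed.

Lemma pair_tableE i j : i < 9 -> j < 9 ->
  nth 0%Z (nth [::] pair_table i) j = form pair_squares i j.
Proof. exact: (@form_tableE pair_squares). Qed.

(** For one weighted linear form the double sum factors as the weight times a square, so only the
    signs of the weights matter. *)
Lemma sum_form_ge0 (I : finType) (Q : squares) (f : I -> nat) :
  all (fun s => 0 <=? s.1)%Z Q -> (0 <= \sum_p \sum_q form Q (f p) (f q) :> Z)%R.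
Proof.
elim: Q => [_|[w l] Q IHQ /= /andP[w_ge0 /IHQ]] /=.
  by rewrite big1 // => p _; rewrite big1.
move=> Q_ge0; under eq_bigr do rewrite big_split /=; rewrite big_split /=.
apply: addr_ge0 => //.
have -> : (\sum_p \sum_q w * (nth 0 l (f p) * nth 0 l (f q)))%R =
          (w * (\sum_p nth 0%Z l (f p)) ^+ 2)%R :> Z.
  rewrite expr2 mulr_suml mulr_sumr; apply: eq_bigr => p _.
  by rewrite mulr_sumr mulr_sumr.
by apply: mulr_ge0; [exact: w_ge0 | exact: sqr_ge0].
Qed.

(* The pairs inside the type {a, b, c, d} that form an edge with a further vertex
   matter only up to automorphisms of the type, which has edges abc and abd.
   Orbits without a coordinate in the forms are sent to 6, where nth returns 0. *)
Definition cherry_flag (ab ac ad bc bd cd : bool) : nat :=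
  if ab then
    if cd then (if ac + ad + bc + bd is 1 then 4 else 6)
    else match ac, ad, bc, bd with
         | false, false, false, false => 0
         | true, true, false, false | false, false, true, true => 1
         | true, false, false, true | false, true, true, false => 2
         | _, _, _, _ => 6
         end
  else if [&& ac, ad, bc & bd] then (if cd then 5 else 3) else 6.

(* The type has edges abc, abd, acd. Its automorphisms permute the three pairs of
   opposite edges {ab, cd}, {ac, bd}, {ad, bc}. *)
Definition apex_flag (ab ac ad bc bd cd : bool) : nat :=
  match (ab && ~~ cd) + (ac && ~~ bd) + (ad && ~~ bc),
        (~~ ab && cd) + (~~ ac && bd) + (~~ ad && bc),
        (ab && cd) + (ac && bd) + (ad && bc) with
  | 1, 0, 0 => 0 | 2, 0, 0 => 1 | 3, 0, 0 => 2 | 1, 0, 1 => 3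
  | 1, 2, 0 => 4 | 0, 0, 2 => 5 | 0, 3, 0 => 6 | 0, 2, 1 => 7
  | _, _, _ => 8
  end.

(* The type is the pair a, b, and the flag adds the pair c, d. *)
Definition pair_flag (abc abd acd bcd : bool) : nat :=
  match acd + bcd with 0 => 0 | 1 => 3 | _ => 6 end + (abc + abd).

Definition cherry_value (abc abd acd bcd abp acp adp bcp bdp cdp
    abq acq adq bcq bdq cdq : bool) : Z :=
  if [&& abc, abd, ~~ acd & ~~ bcd] then
    nth 0%Z (nth [::] cherry_table (cherry_flag abp acp adp bcp bdp cdp))
            (cherry_flag abq acq adq bcq bdq cdq)
  else 0%Z.

(* 100776960 = 4 * 25194240: every K4^- has exactly one apex among its vertices. *)
Definition apex_value (abc abd acd bcd abp acp adp bcp bdp cdp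
    abq acq adq bcq bdq cdq : bool) : Z :=
  if [&& abc, abd, acd & ~~ bcd] then
    (100776960 + nth 0 (nth [::] apex_table (apex_flag abp acp adp bcp bdp cdp))
            (apex_flag abq acq adq bcq bdq cdq))%Z
  else 0%Z.

Definition pair_value (abc abd acd bcd abp abq apq bpq : bool) : Z :=
  nth 0%Z (nth [::] pair_table (pair_flag abc abd acd bcd)) (pair_flag abp abq apq bpq).

Lemma cherry_flag_lt ab ac ad bc bd cd : cherry_flag ab ac ad bc bd cd < 9.
Proof. by case: ab ac ad bc bd cd => [] [] [] [] [] []. Qed.

Lemma apex_flag_lt ab ac ad bc bd cd : apex_flag ab ac ad bc bd cd < 9.
Proof. by case: ab ac ad bc bd cd => [] [] [] [] [] []. Qed.

Lemma pair_flag_lt abc abd acd bcd : pair_flag abc abd acd bcd < 9.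
Proof. by case: abc abd acd bcd => [] [] [] []. Qed.

Section Terms.
Variables (T : Type) (e : T -> T -> T -> bool).

Definition cherry_term (a b c d p q : T) :=
  cherry_value (e a b c) (e a b d) (e a c d) (e b c d)
  (e a b p) (e a c p) (e a d p) (e b c p) (e b d p) (e c d p)
  (e a b q) (e a c q) (e a d q) (e b c q) (e b d q) (e c d q).

Definition apex_term (a b c d p q : T) :=
  apex_value (e a b c) (e a b d) (e a c d) (e b c d)
  (e a b p) (e a c p) (e a d p) (e b c p) (e b d p) (e c d p)
  (e a b q) (e a c q) (e a d q) (e b c q) (e b d q) (e c d q).

Definition pair_term (a b c d p q : T) :=
  pair_value (e a b c) (e a b d) (e a c d) (e b c d)
  (e a b p) (e a b q) (e a p q) (e b p q).

End Terms.

Definition app6 (A B : Type) (z : B) (f : A -> A -> A -> A -> A -> A -> B) (s : seq A) : B :=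
  if s is [:: a; b; c; d; p; q] then f a b c d p q else z.

Lemma sum_addl (V : finType) (C : Z) (F : V -> V -> Z) :
  (\sum_p \sum_q Z.add C (F p q) = C *+ (#|V| ^ 2)%N + \sum_p \sum_q F p q)%R.
Proof.
transitivity (\sum_(p : V) (C *+ #|V| + \sum_q F p q))%R.
  by apply: eq_bigr => p _; rewrite -sumr_const -big_split.
by rewrite big_split /= sumr_const -mulrnA mulnn.
Qed.

Section TermSums.
Variables (V : finType) (e : V -> V -> V -> bool).

Definition apex (a b c d : V) := [&& e a b c, e a b d, e a c d & ~~ e b c d].

Lemma sum_cherry_term_ge0 :
  (0 <= \sum_a \sum_b \sum_c \sum_d \sum_p \sum_q cherry_term e a b c d p q :> Z)%R.
Proof.
do 4!apply: sumr_ge0 => ? _; rewrite /cherry_term /cherry_value.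
case: [&& _, _, _ & _]; last first.
  by rewrite big1 // => p _; rewrite big1.
under eq_bigr do under eq_bigr do rewrite cherry_tableE ?cherry_flag_lt //.
exact: (sum_form_ge0 (Q := cherry_squares)).
Qed.

Lemma sum_pair_term_ge0 :
  (0 <= \sum_a \sum_b \sum_c \sum_d \sum_p \sum_q pair_term e a b c d p q :> Z)%R.
Proof.
(* The type is only the pair a, b: each flag ranges over pairs, so (c, d) and (p, q) are merged into
   one index each. *)
do 2!apply: sumr_ge0 => ? _; rewrite pair_bigA /=.
under eq_bigr do rewrite pair_bigA /=.
rewrite /pair_term /pair_value.
under eq_bigr do under eq_bigr do rewrite pair_tableE ?pair_flag_lt //.
exact: (sum_form_ge0 (Q := pair_squares) (fun y => pair_flag _ _ _ _)).
Qed.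

Lemma sum_apex_term_ge :
  (\sum_a \sum_b \sum_c \sum_d (if apex a b c d then 100776960%Z *+ (#|V| ^ 2)%N else 0) <=
   \sum_a \sum_b \sum_c \sum_d \sum_p \sum_q apex_term e a b c d p q :> Z)%R.
Proof.
do 4!apply: ler_sum => ? _; rewrite /apex_term /apex_value /apex.
case: [&& _, _, _ & _]; last first.
  by rewrite [leRHS]big1 // => p _; rewrite big1.
under eq_bigr do under eq_bigr do rewrite apex_tableE ?apex_flag_lt //.
rewrite sum_addl lerDl.
exact: (sum_form_ge0 (Q := apex_squares)).
Qed.

End TermSums.

(** * Averaging over relabellings *)

Definition perms6 := permutations (iota 0 6).

Section Ffun6.
Variable V : finType.

Definition pt (x : {ffun 'I_6 -> V}) (i : nat) : V := x (inord i).

Definition relabel (x : {ffun 'I_6 -> V}) (s : {perm 'I_6}) : {ffun 'I_6 -> V} :=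
  [ffun i => x (s i)].

Definition perm_list (s : {perm 'I_6}) : seq nat :=
  [seq nat_of_ord (s (inord k)) | k <- iota 0 6].

Lemma pt_relabel x s i : pt (relabel x s) i = pt x (s (inord i)).
Proof. by rewrite /pt ffunE inord_val. Qed.

Lemma sum_ffun6 (F : V -> V -> V -> V -> V -> V -> Z) :
  (\sum_(x : {ffun 'I_6 -> V}) F (pt x 0) (pt x 1) (pt x 2) (pt x 3) (pt x 4) (pt x 5) =
   \sum_a \sum_b \sum_c \sum_d \sum_p \sum_q F a b c d p q)%R.
Proof.
rewrite !pair_bigA /=.
pose list_of (u : V * V * V * V * V * V) :=
  [:: u.1.1.1.1.1; u.1.1.1.1.2; u.1.1.1.2; u.1.1.2; u.1.2; u.2].
rewrite (reindex (fun u => [ffun i : 'I_6 => nth u.2 (list_of u) i])) /=.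
  apply: eq_bigr => -[[[[[a b] c] d] p] q] _.
  by rewrite /pt !ffunE !inordK.
exists (fun x => (pt x 0, pt x 1, pt x 2, pt x 3, pt x 4, pt x 5)).
  by move=> [[[[[a b] c] d] p] q] _; rewrite /pt !ffunE !inordK.
move=> x _; apply/ffunP => i; rewrite ffunE /list_of /= /pt.
case: i => [[|[|[|[|[|[|//]]]]]] i6] /=; congr (x _); apply: val_inj;
  by rewrite /= inordK.
Qed.

Lemma relabel_inj s : injective (relabel^~ s).
Proof.
move=> x y /ffunP xy; apply/ffunP => i.
by have := xy ((s^-1)%g i); rewrite !ffunE permKV.
Qed.

Lemma relabelM x s t : relabel (relabel x s) t = relabel x (t * s)%g.
Proof. by apply/ffunP => i; rewrite !ffunE permM. Qed.

End Ffun6.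

Lemma perm_list_inj : injective perm_list.
Proof.
move=> s t st; apply/permP => i; apply: val_inj.
have /(congr1 (nth 0 ^~ i)) := st.
by rewrite !(nth_map 0) ?size_iota // !nth_iota // inord_val.
Qed.

Lemma perm_list_perms6 s : perm_list s \in perms6.
Proof.
rewrite mem_permutations uniq_perm ?iota_uniq //.
  rewrite map_inj_in_uniq ?iota_uniq // => i j; rewrite !mem_iota /= => i6 j6.
  by move=> /val_inj/perm_inj/(congr1 val); rewrite /= !inordK.
move=> i; rewrite mem_iota /=; apply/mapP/idP => [[k _ ->] //| i6].
exists (val ((s^-1)%g (inord i))); first by rewrite mem_iota /=.
by rewrite inord_val permKV inordK.
Qed.

Lemma uniq_subset_perm (T : eqType) (s1 s2 : seq T) :
  uniq s1 -> {subset s1 <= s2} -> size s2 <= size s1 -> perm_eq s1 s2.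
Proof.
move=> U1 s12 le21; apply: uniq_perm => //; first exact: leq_size_uniq le21.
by have [] := uniq_min_size U1 s12 le21.
Qed.

(** [perm_list] is injective with values in [perms6], and both lists have 720 entries. *)
Lemma perms6E : perm_eq [seq perm_list s | s <- enum {perm 'I_6}] perms6.
Proof.
apply: uniq_subset_perm.
- by rewrite map_inj_uniq ?enum_uniq //; exact: perm_list_inj.
- by move=> _ /mapP[s _ ->]; exact: perm_list_perms6.
- by rewrite size_permutations ?iota_uniq // size_map size_iota -cardE card_Sn.
Qed.

(** * Summation over the 720 relabellings by cosets *)

Definition compose_list (t s : seq nat) : seq nat := [seq nth 0 t i | i <- s].

(** The compositions are distinct and numerous enough to exhaust [perms6], so [L] represents the
    cosets of [S]; an [F] constant on each coset is evaluated once per coset. *)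
Lemma sum_perms6_cosets (L S : seq (seq nat)) (F : seq nat -> Z) :
  let LS := [seq compose_list t s | t <- L, s <- S] in
  uniq LS -> all [in perms6] LS -> size perms6 <= size LS ->
  (forall t s, t \in L -> s \in S -> F (compose_list t s) = F t) ->
  (\sum_(t <- perms6) F t = \sum_(t <- L) F t *+ size S)%R.
Proof.
move=> LS uLS /allP LS6 le6 Finv.
rewrite -(perm_big _ (uniq_subset_perm uLS LS6 le6)) /= big_allpairs_dep /=.
apply: eq_big_seq => t tL; rewrite (eq_big_seq (fun _ => F t)).
  by rewrite big_const_seq count_predT iter_addr_0.
by move=> s sS; rewrite Finv.
Qed.

Definition nth_lt (s : seq nat) i j := nth 0 s i < nth 0 s j.

(** The terms are invariant under groups of position swaps of orders 8, 12 and 16. Ordering the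
    values at exchangeable positions selects 90, 60 and 45 representatives. *)
Definition cherry_reps := Eval vm_compute in
  [seq s <- perms6 | [&& nth_lt s 0 1, nth_lt s 2 3 & nth_lt s 4 5]].
Definition apex_reps := Eval vm_compute in
  [seq s <- perms6 | [&& nth_lt s 1 2, nth_lt s 2 3 & nth_lt s 4 5]].
Definition pair_reps := Eval vm_compute in
  [seq s <- perms6 | [&& nth_lt s 0 1, nth_lt s 2 3, nth_lt s 4 5 & nth_lt s 2 4]].

Definition cherry_stab := Eval vm_compute in
  [seq s <- perms6 | perm_eq (take 2 s) [:: 0; 1]
                     && perm_eq (take 2 (drop 2 s)) [:: 2; 3]].
Definition apex_stab := Eval vm_compute in
  [seq s <- perms6 | (head 0 s == 0) && perm_eq (take 4 s) (iota 0 4)].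
Definition pair_stab := Eval vm_compute in
  [seq s <- perms6 | perm_eq (take 2 s) [:: 0; 1]
    && has (perm_eq (take 2 (drop 2 s))) [:: [:: 2; 3]; [:: 4; 5]]].

Section Symmetry.
Variables (T : Type) (e : T -> T -> T -> bool).
Hypothesis e_swap12 : forall a b c, e a b c = e b a c.
Hypothesis e_swap23 : forall a b c, e a b c = e a c b.

Lemma cherry_flag_swap01 ab ac ad bc bd cd :
  cherry_flag ab bc bd ac ad cd = cherry_flag ab ac ad bc bd cd.
Proof. by case: ab ac ad bc bd cd => [] [] [] [] [] []. Qed.

Lemma cherry_flag_swap23 ab ac ad bc bd cd :
  cherry_flag ab ad ac bd bc cd = cherry_flag ab ac ad bc bd cd.
Proof. by case: ab ac ad bc bd cd => [] [] [] [] [] []. Qed.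

Lemma apex_flag_swap12 ab ac ad bc bd cd :
  apex_flag ac ab ad bc cd bd = apex_flag ab ac ad bc bd cd.
Proof. by case: ab ac ad bc bd cd => [] [] [] [] [] []. Qed.

Lemma apex_flag_swap23 ab ac ad bc bd cd :
  apex_flag ab ad ac bd bc cd = apex_flag ab ac ad bc bd cd.
Proof. by case: ab ac ad bc bd cd => [] [] [] [] [] []. Qed.

Lemma form_sym Q i j : form Q i j = form Q j i.
Proof.
by elim: Q => //= s Q ->; rewrite (Z.mul_comm (nth 0%Z s.2 i)).
Qed.

Lemma cherry_term_swap01 a b c d p q : cherry_term e b a c d p q = cherry_term e a b c d p q.
Proof.
rewrite /cherry_term !(e_swap12 b a) /cherry_value !(cherry_flag_swap01 _ (e a c _)).
by rewrite (andbC (~~ e b c d)).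
Qed.

Lemma cherry_term_swap23 a b c d p q : cherry_term e a b d c p q = cherry_term e a b c d p q.
Proof.
rewrite /cherry_term !(e_swap23 _ d c) (e_swap12 d c p) (e_swap12 d c q).
rewrite /cherry_value !(cherry_flag_swap23 _ (e a c _)).
by rewrite andbCA.
Qed.

Lemma cherry_term_swap45 a b c d p q : cherry_term e a b c d q p = cherry_term e a b c d p q.
Proof. by rewrite /cherry_term /cherry_value !cherry_tableE ?cherry_flag_lt // form_sym. Qed.

Lemma apex_term_swap12 a b c d p q : apex_term e a c b d p q = apex_term e a b c d p q.
Proof.
rewrite /apex_term !(e_swap23 _ c b) !(e_swap12 c b) /apex_value !(apex_flag_swap12 (e a b _)).
by rewrite (andbCA (e a c d)).
Qed.

Lemma apex_term_swap23 a b c d p q : apex_term e a b d c p q = apex_term e a b c d p q.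
Proof.
rewrite /apex_term !(e_swap23 _ d c) (e_swap12 d c p) (e_swap12 d c q).
rewrite /apex_value !(apex_flag_swap23 _ (e a c _)).
by rewrite andbCA.
Qed.

Lemma apex_term_swap45 a b c d p q : apex_term e a b c d q p = apex_term e a b c d p q.
Proof. by rewrite /apex_term /apex_value !apex_tableE ?apex_flag_lt // form_sym. Qed.

Lemma pair_term_swap01 a b c d p q : pair_term e b a c d p q = pair_term e a b c d p q.
Proof.
by rewrite /pair_term !(e_swap12 b a) /pair_value /pair_flag (addnC (e b c d)) (addnC (e b p q)).
Qed.

Lemma pair_term_swap23 a b c d p q : pair_term e a b d c p q = pair_term e a b c d p q.
Proof. by rewrite /pair_term !(e_swap23 _ d c) /pair_value /pair_flag (addnC (e a b d)). Qed.

Lemma pair_term_swap45 a b c d p q : pair_term e a b c d q p = pair_term e a b c d p q.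
Proof. by rewrite /pair_term !(e_swap23 _ q p) /pair_value /pair_flag (addnC (e a b q)). Qed.

Lemma pair_term_swap a b c d p q : pair_term e a b p q c d = pair_term e a b c d p q.
Proof. by rewrite /pair_term /pair_value !pair_tableE ?pair_flag_lt // form_sym. Qed.

End Symmetry.

(** Bounded search for a word in the generating swaps. The bounds 3, 4 and 4 used below are the
    greatest word lengths needed in the three groups; when there are only three generators, the last
    is passed twice. *)
Local Ltac swap_search s1 s2 s3 s4 n :=
  first [ reflexivity
        | match n with S ?m =>
            first [ rewrite s1; swap_search s1 s2 s3 s4 m
                  | rewrite s2; swap_search s1 s2 s3 s4 m
                  | rewrite s3; swap_search s1 s2 s3 s4 m
                  | rewrite s4; swap_search s1 s2 s3 s4 m ]
          end ].

Section Cosets.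
Variable e : nat -> nat -> nat -> bool.
Hypothesis e_swap12 : forall a b c, e a b c = e b a c.
Hypothesis e_swap23 : forall a b c, e a b c = e a c b.

Let sum_perms (F : nat -> nat -> nat -> nat -> nat -> nat -> Z) :=
  (\sum_(t <- perms6) app6 0%Z F t)%R.

Lemma size6 (L : seq (seq nat)) t : all (fun s => size s == 6) L -> t \in L ->
  exists a b c d p q, t = [:: a; b; c; d; p; q].
Proof.
move=> /allP L6 /L6; case: t => [|a[|b[|c[|d[|p[|q[|//]]]]]]] // _.
by exists a, b, c, d, p, q.
Qed.

Lemma sum_cherry_term_cosets :
  (sum_perms (cherry_term e) = \sum_(t <- cherry_reps) app6 0%Z (cherry_term e) t *+ 8)%R.
Proof.
apply: (@sum_perms6_cosets cherry_reps cherry_stab); [by vm_compute.. |].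
move=> t s /size6[//|a [b [c [d [p [q ->]]]]]].
have s01 := cherry_term_swap01 e_swap12; have s23 := cherry_term_swap23 e_swap12 e_swap23.
have s45 := cherry_term_swap45 e.
rewrite /cherry_stab !inE; do ?[case/orP]; move=> /eqP ->; rewrite /= /app6;
  swap_search s01 s23 s45 s45 3.
Qed.

Lemma sum_apex_term_cosets :
  (sum_perms (apex_term e) = \sum_(t <- apex_reps) app6 0%Z (apex_term e) t *+ 12)%R.
Proof.
apply: (@sum_perms6_cosets apex_reps apex_stab); [by vm_compute.. |].
move=> t s /size6[//|a [b [c [d [p [q ->]]]]]].
have s12 := apex_term_swap12 e_swap12 e_swap23; have s23 := apex_term_swap23 e_swap12 e_swap23.
have s45 := apex_term_swap45 e.
rewrite /apex_stab !inE; do ?[case/orP]; move=> /eqP ->; rewrite /= /app6;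
  swap_search s12 s23 s45 s45 4.
Qed.

Lemma sum_pair_term_cosets :
  (sum_perms (pair_term e) = \sum_(t <- pair_reps) app6 0%Z (pair_term e) t *+ 16)%R.
Proof.
apply: (@sum_perms6_cosets pair_reps pair_stab); [by vm_compute.. |].
move=> t s /size6[//|a [b [c [d [p [q ->]]]]]].
have s01 := pair_term_swap01 e_swap12; have s23 := pair_term_swap23 e_swap23.
have s45 := pair_term_swap45 e_swap23; have sb := pair_term_swap e.
rewrite /pair_stab !inE; do ?[case/orP]; move=> /eqP ->; rewrite /= /app6;
  swap_search s01 s23 s45 sb 4.
Qed.

End Cosets.

(** * The inequality on six vertices *)

(* Colexicographic order: the first ten triples are those of the first five
   vertices, and likewise for the first five quadruples. *)
Definition triples6 : seq (seq nat) := Eval vm_compute in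
  [seq s <- [seq i :: jk | jk <- [seq [:: j; k] | k <- iota 0 6, j <- iota 0 6],
                           i <- iota 0 6] | sorted ltn s].

Definition quads6 : seq (seq nat) := Eval vm_compute in
  [seq s <- [seq [:: ij.1; ij.2; kl.1; kl.2]
             | kl <- [seq (k, l) | l <- iota 0 6, k <- iota 0 6],
               ij <- [seq (i, j) | j <- iota 0 6, i <- iota 0 6]] | sorted ltn s].

Definition app3 (A B : Type) (z : B) (f : A -> A -> A -> B) (s : seq A) : B :=
  if s is [:: a; b; c] then f a b c else z.

Definition app4 (A B : Type) (z : B) (f : A -> A -> A -> A -> B) (s : seq A) : B :=
  if s is [:: a; b; c; d] then f a b c d else z.

Definition code (e : nat -> nat -> nat -> bool) : seq bool :=
  [seq app3 false e t | t <- triples6].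

(** Sorting makes the decoded relation symmetric. A triple with a repetition is absent from
    [triples6], so its index is 20 and, for at most 20 bits, the default [false] is read. *)
Definition decode (b : seq bool) (i j k : nat) : bool :=
  nth false b (index (sort leq [:: i; j; k]) triples6).

Definition notK4 (abc abd acd bcd : bool) := ~~ [&& abc, abd, acd & bcd].

(* A synonym that stays folded when the evaluation below leaves the twenty edge
   indicators symbolic. *)
Definition conjb := andb.

Definition K4free_on (Q : seq (seq nat)) (e : nat -> nat -> nat -> bool) : bool :=
  foldr conjb true
    [seq app4 true (fun i j k l => notK4 (e i j k) (e i j l) (e i k l) (e j k l)) s
    | s <- Q].

Definition sumZ := foldr Z.add 0%Z.

(* A quarter of the sum of the 720 relabelled local defects:
   2687385600 = 180 * 14929920, where 14929920 = 16 / 27 * 25194240. *)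
Definition defect (e : nat -> nat -> nat -> bool) : Z :=
  (2687385600 - (2 * sumZ [seq app6 0 (cherry_term e) t | t <- cherry_reps]
    + (3 * sumZ [seq app6 0 (apex_term e) t | t <- apex_reps]
      + 4 * sumZ [seq app6 0 (pair_term e) t | t <- pair_reps])))%Z.

Definition defect_ge0 (b : seq bool) : bool :=
  K4free_on quads6 (decode b) ==> (0 <=? defect (decode b))%Z.

(** Evaluating with symbolic bits resolves all sorting and index lookups once and for all; each of
    the 23 * 1024 later checks only evaluates what is left. *)
Definition defect_ge0_20 :=
  Eval lazy -[cherry_value apex_value pair_value Z.add Z.mul Z.sub conjb notK4 implb Z.leb] in
  fun b0 b1 b2 b3 b4 b5 b6 b7 b8 b9 b10 b11 b12 b13 b14 b15 b16 b17 b18 b19 =>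
  defect_ge0 [:: b0; b1; b2; b3; b4; b5; b6; b7; b8; b9;
                 b10; b11; b12; b13; b14; b15; b16; b17; b18; b19].

Definition defect_ge0_list (b : seq bool) : bool :=
  if b is [:: b0; b1; b2; b3; b4; b5; b6; b7; b8; b9;
              b10; b11; b12; b13; b14; b15; b16; b17; b18; b19]
  then defect_ge0_20 b0 b1 b2 b3 b4 b5 b6 b7 b8 b9
                     b10 b11 b12 b13 b14 b15 b16 b17 b18 b19
  else false.

Lemma defect_ge0_listP b : defect_ge0_list b -> defect_ge0 b.
Proof.
by case: b => [|b0 [|b1 [|b2 [|b3 [|b4 [|b5 [|b6 [|b7 [|b8 [|b9 [|b10 [|b11 [|b12
  [|b13 [|b14 [|b15 [|b16 [|b17 [|b18 [|b19 [|//]]]]]]]]]]]]]]]]]]]]].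
Qed.

Fixpoint all_bits n (f : seq bool -> bool) : bool :=
  if n is n'.+1 then
    all_bits n' (fun s => f (true :: s)) && all_bits n' (fun s => f (false :: s))
  else f [::].

Lemma all_bitsP n f : all_bits n f -> forall s, size s = n -> f s.
Proof.
elim: n f => [|n IHn] f /= => [? [] //|/andP[/IHn fT /IHn fF] [//|[] s] /= [/eqP sz]].
  by apply: fT; apply/eqP.
by apply: fF; apply/eqP.
Qed.

(* One bit mask for each isomorphism class of K4-free 3-graphs on five vertices. *)
Definition reps5 : seq (seq bool) := Eval vm_compute in
  [seq [seq odd (m %/ 2 ^ i) | i <- iota 0 10]
  | m <- [:: 0; 1; 3; 7; 19; 20; 21; 23; 28; 29; 54; 55; 58; 59; 62; 126; 183; 184;
             185; 187; 220; 221; 254]].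

(** In colexicographic order the last ten bits are exactly the triples through the sixth vertex, so
    [s] runs over all one-vertex extensions of [r]. *)
Lemma reps5_defect_ge0 :
  all (fun r => all_bits 10 (fun s => defect_ge0_list (r ++ s))) reps5.
Proof. by vm_compute. Qed.

Definition code_along (t : seq nat) (b : seq bool) : seq bool :=
  [seq app3 false (decode b) (compose_list t s) | s <- take 10 triples6].

Lemma reps5_complete :
  all_bits 10 (fun b => K4free_on (take 5 quads6) (decode b) ==>
    has (fun t => code_along t b \in reps5) (permutations (iota 0 5))).
Proof. by vm_compute. Qed.

Section Decode.
Variable e : nat -> nat -> nat -> bool.
Hypothesis e_swap12 : forall a b c, e a b c = e b a c.
Hypothesis e_swap23 : forall a b c, e a b c = e a c b.

Lemma app3_perm i j k s : perm_eq s [:: i; j; k] -> uniq s ->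
  app3 false e s = e i j k.
Proof.
move=> ps; have := perm_size ps; have := perm_mem ps.
case: s {ps} => [|a [|b [|c [|//]]]] //= ms _.
have: all [in [:: i; j; k]] [:: a; b; c] by apply/allP => z; rewrite /= -ms.
rewrite /= !inE => /and4P[/or3P[] /eqP-> /or3P[] /eqP-> /or3P[] /eqP-> _];
  rewrite ?eqxx ?orbT ?andbF //= => _;
  by [|rewrite e_swap12|rewrite e_swap23|rewrite e_swap12 e_swap23
      |rewrite e_swap23 e_swap12|rewrite e_swap12 e_swap23 e_swap12].
Qed.

Lemma mem_triples6 i j k : uniq [:: i; j; k] -> all (gtn 6) [:: i; j; k] ->
  sort leq [:: i; j; k] \in triples6.
Proof.
have: all (fun i => all (fun j => all (fun k => uniq [:: i; j; k] ==>
   (sort leq [:: i; j; k] \in triples6)) (iota 0 6)) (iota 0 6)) (iota 0 6).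
  by vm_compute.
move=> H U /and4P[i6 j6 k6 _].
move/allP/(_ i): H; rewrite mem_iota => /(_ i6)/allP/(_ j); rewrite mem_iota.
by move=> /(_ j6)/allP/(_ k); rewrite mem_iota => /(_ k6)/implyP/(_ U).
Qed.

Lemma decode_code i j k : uniq [:: i; j; k] -> all (gtn 6) [:: i; j; k] ->
  decode (code e) i j k = e i j k.
Proof.
move=> U lt6; have m6 := mem_triples6 U lt6.
rewrite /decode /code (nth_map [::]) ?index_mem // nth_index //.
by apply: app3_perm; rewrite ?sort_uniq // perm_sort.
Qed.

Lemma size_code : size (code e) = 20.
Proof. by rewrite size_map. Qed.

End Decode.

Local Ltac split_andb := repeat match goal with
  | H : is_true (_ && _) |- _ => case/andP: H => ? ?
  | |- is_true (_ && _) => apply/andP; split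
  end; try assumption.

(** The permuted terms and the quadruples of [quads6] read a relation only at such triples, and only
    there does [decode] invert [code]. *)
Definition agree (e e' : nat -> nat -> nat -> bool) :=
  forall i j k, uniq [:: i; j; k] -> all (gtn 6) [:: i; j; k] -> e i j k = e' i j k.

Lemma agree_terms e e' t : agree e e' -> t \in perms6 ->
  [/\ app6 0%Z (cherry_term e) t = app6 0%Z (cherry_term e') t,
      app6 0%Z (apex_term e) t = app6 0%Z (apex_term e') t &
      app6 0%Z (pair_term e) t = app6 0%Z (pair_term e') t].
Proof.
move=> ee'; rewrite mem_permutations => t6.
have : uniq t by rewrite (perm_uniq t6).
have : all (gtn 6) t by rewrite (perm_all _ t6).
have := perm_size t6; case: t t6 => [|a[|b[|c[|d[|p[|q[|//]]]]]]] // _ _.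
rewrite /= !inE !negb_or => lt6 U.
have E i j k : [&& i != j, i != k, j != k, i < 6, j < 6 & k < 6] -> e i j k = e' i j k.
  by move=> H; apply: ee'; rewrite /= ?inE ?negb_or; split_andb.
by split; rewrite /cherry_term /apex_term /pair_term !E; split_andb.
Qed.

Lemma agree_sum F F' : (forall t, t \in perms6 -> F t = F' t) ->
  forall L, all [in perms6] L -> sumZ [seq F t | t <- L] = sumZ [seq F' t | t <- L].
Proof.
move=> FF' L /allP L6; congr sumZ; apply/eq_in_map => t tL.
by apply: FF'; exact: L6.
Qed.

Lemma agree_defect e e' : agree e e' -> defect e = defect e'.
Proof.
move=> ee'; rewrite /defect; congr (_ - (2 * _ + (3 * _ + 4 * _)))%Z;
  by apply: agree_sum; [move=> t /(agree_terms ee')[]|vm_compute].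
Qed.

Lemma agree_K4free e e' Q : agree e e' -> {subset Q <= quads6} ->
  K4free_on Q e -> K4free_on Q e'.
Proof.
move=> ee' Q6; suff -> : K4free_on Q e = K4free_on Q e' by [].
congr (foldr _ _ _); apply/eq_in_map => s /Q6.
have /allP/(_ s) : all (fun s => uniq s && all (gtn 6) s) quads6 by vm_compute.
move=> /[apply]; case: s => [|i[|j[|k[|l[|//]]]]] //=.
rewrite /= !inE !negb_or => lt6.
have E a b c : [&& a != b, a != c, b != c, a < 6, b < 6 & c < 6] -> e a b c = e' a b c.
  by move=> H; apply: ee'; rewrite /= ?inE ?negb_or; split_andb.
by rewrite !E; split_andb.
Qed.

(** * The upper bound *)

Lemma sumZE (I : Type) (F : I -> Z) (L : seq I) :
  sumZ [seq F t | t <- L] = (\sum_(t <- L) F t)%R.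
Proof. by elim: L => [|t L IHL]; rewrite ?big_nil ?big_cons //= IHL. Qed.

Lemma mulrnZ (z : Z) n : (z *+ n)%R = Z.mul z (Z.of_nat n).
Proof. by elim: n => [|n IHn]; rewrite ?mulr0n ?mulrS ?IHn; lia. Qed.

Section UpperBound.
Variables (V : finType) (e : V -> V -> V -> bool).
Hypothesis e_swap12 : forall a b c, e a b c = e b a c.
Hypothesis e_swap23 : forall a b c, e a b c = e a c b.
Hypothesis K4free : forall a b c d, ~~ [&& e a b c, e a b d, e a c d & e b c d].

Let E (x : {ffun 'I_6 -> V}) (i j k : nat) := e (pt x i) (pt x j) (pt x k).

Let E_swap12 x a b c : E x a b c = E x b a c. Proof. exact: e_swap12. Qed.
Let E_swap23 x a b c : E x a b c = E x a c b. Proof. exact: e_swap23. Qed.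

Definition local_defect (h : nat -> nat -> nat -> bool) (t : seq nat) : Z :=
  (14929920%Z - (app6 0%Z (cherry_term h) t +
    (app6 0%Z (apex_term h) t + app6 0%Z (pair_term h) t)))%R.

Lemma local_defect_relabel x s :
  local_defect (E (relabel x s)) (iota 0 6) = local_defect (E x) (perm_list s).
Proof. by rewrite /local_defect /= /cherry_term /apex_term /pair_term /E !pt_relabel. Qed.

Lemma sum_local_defect x :
  (\sum_s local_defect (E (relabel x s)) (iota 0 6) = defect (E x) *+ 4)%R.
Proof.
under eq_bigr do rewrite local_defect_relabel.
rewrite -(big_enum _ _ _ (local_defect (E x) \o perm_list)) /=.
rewrite -(big_map perm_list xpredT (local_defect (E x))) (perm_big _ perms6E) /=.
rewrite /local_defect sumrB !big_split /= big_const_seq count_predT iter_addr_0.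
(* The coset sizes 8, 12, 16 are four times the coefficients 2, 3, 4 in [defect]. *)
rewrite sum_cherry_term_cosets // sum_apex_term_cosets // sum_pair_term_cosets //.
rewrite !sumrMnl -!sumZE.
rewrite size_permutations ?iota_uniq // size_iota /defect !mulrnZ.
rewrite -[Z.of_nat 6`!]/720%Z; lia.
Qed.

Lemma defect_ge0_of_rep x : take 10 (code (E x)) \in reps5 -> (0 <= defect (E x))%Z.
Proof.
have agr : agree (E x) (decode (code (E x))).
  by move=> i j k U lt6; rewrite decode_code.
move=> r5; rewrite (agree_defect agr).
have /allP/(_ _ r5)/all_bitsP/(_ (drop 10 (code (E x)))) := reps5_defect_ge0.
rewrite cat_take_drop size_drop size_code => /(_ erefl)/defect_ge0_listP.
rewrite /defect_ge0 => /implyP/(_ _)/Z.leb_le; apply.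
apply: agree_K4free agr _ _ => //.
(* One application for each of the 15 quadruples of indices; the points of [x] may coincide, which
   [K4free] covers. *)
by do 15!(apply/andP; split; first exact: K4free).
Qed.

Lemma decode_take i j k b : uniq [:: i; j; k] -> all (gtn 5) [:: i; j; k] ->
  decode (take 10 b) i j k = decode b i j k.
Proof.
have: all (fun i => all (fun j => all (fun k => uniq [:: i; j; k] ==>
   (index (sort leq [:: i; j; k]) triples6 < 10)) (iota 0 5)) (iota 0 5)) (iota 0 5).
  by vm_compute.
move=> H U /and4P[i5 j5 k5 _]; rewrite /decode nth_take //.
move/allP/(_ i): H; rewrite mem_iota => /(_ i5)/allP/(_ j); rewrite mem_iota.
by move=> /(_ j5)/allP/(_ k); rewrite mem_iota => /(_ k5)/implyP/(_ U).
Qed.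

(** The first ten bits involve only the indices below 5, so a relabelling [t] supplied by
    [reps5_complete] is extended by fixing 5. *)
Lemma exists_rep x : exists s, take 10 (code (E (relabel x s))) \in reps5.
Proof.
have size10 : size (take 10 (code (E x))) = 10 by rewrite size_take size_code.
have decode10 i j k : uniq [:: i; j; k] -> all (gtn 5) [:: i; j; k] ->
    decode (take 10 (code (E x))) i j k = E x i j k.
  move=> U lt5; rewrite decode_take // decode_code //.
  by apply: sub_all lt5 => z /= /ltnW.
have /implyP has_rep := all_bitsP reps5_complete size10.
have /has_rep/hasP[t] : K4free_on (take 5 quads6) (decode (take 10 (code (E x)))).
  by do 5!(apply/andP; split; first by rewrite /app4 /notK4 !decode10 //; exact: K4free).
rewrite mem_permutations => t5 tr.
have t6 : rcons t 5 \in perms6.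
  by rewrite mem_permutations (perm_rcons 5 t) -[iota 0 6]/(rcons (iota 0 5) 5)
             perm_sym perm_rcons perm_cons perm_sym.
have [s st] : exists s, perm_list s = rcons t 5.
  by move: t6; rewrite -(perm_mem perms6E) => /mapP[s _ ->]; exists s.
have size_t : size t = 5 by rewrite (perm_size t5).
have pts i : i < 5 -> pt (relabel x s) i = pt x (nth 0 t i).
  move=> i5; rewrite pt_relabel; congr (pt x _).
  have := congr1 (nth 0 ^~ i) st; rewrite nth_rcons size_t i5 => <-.
  by rewrite (nth_map 0) ?size_iota ?nth_iota // ltnW.
exists s; suff -> : take 10 (code (E (relabel x s))) = code_along t (take 10 (code (E x))).
  by [].
rewrite /code -map_take; apply/eq_in_map => r r10.
have /allP/(_ r r10) : all (fun r => [&& size r == 3, uniq r & all (gtn 5) r])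
  (take 10 triples6) by vm_compute.
case: r {r10} => [|i [|j [|k [|//]]]] //= /andP[U /and4P[i5 j5 k5 _]].
rewrite decode10 ?{1}/E ?pts //=.
  have ut : uniq t by rewrite (perm_uniq t5).
  by move: U; rewrite !inE !nth_uniq ?size_t.
have lt5 l : l < 5 -> nth 0 t l < 5.
  by move=> l5; rewrite -[_ < 5](mem_iota 0 5) -(perm_mem t5) mem_nth ?size_t.
by rewrite !lt5.
Qed.

(** Some relabelling of [x] is covered by the computation, and the defect is invariant under
    relabelling because four times it is a sum over the whole symmetric group. *)
Lemma defect_nonneg x : (0 <= defect (E x))%Z.
Proof.
have [s] := exists_rep x; move/defect_ge0_of_rep.
suff -> : defect (E (relabel x s)) = defect (E x) by [].
have: (defect (E (relabel x s)) *+ 4 = defect (E x) *+ 4)%R.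
  rewrite -!sum_local_defect [RHS](reindex_inj (mulIg s)) /=.
  by apply: eq_bigr => t _; rewrite relabelM.
by rewrite !mulrnZ; lia.
Qed.

(** Take 720 copies of the sum, reindex the copy of [s] by the bijection [relabel^~ s], and exchange
    the sums: each inner sum is four times a nonnegative defect. *)
Lemma sum_local_defect_ge0 :
  (0 <= \sum_x local_defect (E x) (iota 0 6) :> Z)%R.
Proof.
rewrite -(pmulrn_lge0 _ (fact_gt0 6)) -(card_Sn 6) -sumr_const.
under eq_bigr => s _ do rewrite (reindex_inj (@relabel_inj V s)).
rewrite exchange_big /=; apply: sumr_ge0 => x _.
rewrite sum_local_defect pmulrn_lge0 //; exact/Z.leb_le/defect_nonneg.
Qed.

Lemma apex_bound :
  27 * (\sum_a \sum_b \sum_c \sum_d apex e a b c d) <= 4 * #|V| ^ 4.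
Proof.
set N := (X in 27 * X).
have := sum_local_defect_ge0.
rewrite /local_defect sumrB !big_split /= sumr_const card_ffun card_ord.
rewrite (sum_ffun6 (cherry_term e)) (sum_ffun6 (apex_term e)) (sum_ffun6 (pair_term e)).
rewrite subr_ge0.
have := sum_apex_term_ge e; have := sum_cherry_term_ge0 e; have := sum_pair_term_ge0 e.
have -> : (\sum_a \sum_b \sum_c \sum_d
    (if apex e a b c d then 100776960%Z *+ (#|V| ^ 2)%N else 0) =
    100776960%Z *+ (#|V| ^ 2 * N)%N)%R.
  have Msum (z : Z) I r P (F : I -> nat) :
      (z *+ (\sum_(i <- r | P i) F i)%N = \sum_(i <- r | P i) z *+ F i)%R.
    exact: (big_morph _ (mulrnDr z) (mulr0n z)).
  rewrite [RHS](mulrnA _ (#|V| ^ 2) N) /N Msum; apply: eq_bigr => a _.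
  rewrite Msum; apply: eq_bigr => b _.
  rewrite Msum; apply: eq_bigr => c _.
  rewrite Msum; apply: eq_bigr => d _.
  by case: apex; rewrite ?mulr1n ?mulr0n.
move: (\sum_a \sum_b \sum_c \sum_d \sum_p \sum_q cherry_term e a b c d p q)%R
  (\sum_a \sum_b \sum_c \sum_d \sum_p \sum_q apex_term e a b c d p q)%R
  (\sum_a \sum_b \sum_c \sum_d \sum_p \sum_q pair_term e a b c d p q)%R => X2 X3 X4.
rewrite !mulrnZ => X4_ge0 X2_ge0 X3_ge le6.
(* Here 100776960 / 14929920 = 27 / 4. *)
have le6' : 27 * (#|V| ^ 2 * N) <= 4 * #|V| ^ 6 by lia.
(* The factor [#|V| ^ 2] can be cancelled only if [V] is nonempty; otherwise [N] is an empty sum. *)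
have [n0|n_gt0] := posnP #|V|; last first.
  rewrite -(leq_pmul2l (_ : 0 < #|V| ^ 2)) ?expn_gt0 ?n_gt0 //.
  by rewrite (mulnCA _ 27) (mulnCA _ 4) -expnD.
rewrite [N]big1 ?muln0 // => a _.
by have := max_card (pred1 a); rewrite n0 card1.
Qed.

End UpperBound.

(** * Counting induced copies of K4^- *)

Lemma card_edge (V : finType) (G : graph3 V) (A : {set V}) :
  A \in edges G -> #|A| = 3.
Proof. by case: G => E /= /forall_inP E3 /E3/eqP. Qed.

Lemma card3_I4 (D : {set 'I_4}) : #|D| = 3 -> exists i, D = [set~ i]%SET.
Proof.
move=> D3; have : #|~: D|%SET == 1 by rewrite cardsCs setCK card_ord D3.
by move=> /cards1P[i Di]; exists i; rewrite -Di setCK.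
Qed.

Lemma imset_setC1 (T : finType) (f : T -> T) i :
  injective f -> (f @: [set~ i] = [set~ f i])%SET.
Proof.
move=> f_inj; apply/eqP; rewrite eqEcard card_imset // !cardsC1 leqnn andbT.
by apply/subsetP => _ /imsetP[j + ->]; rewrite !inE (inj_eq f_inj).
Qed.

Lemma imset_setC1_I4 (V : finType) (x : 'I_4 -> V) :
  ((x @: [set~ inord 0] = [set x (inord 1); x (inord 2); x (inord 3)])%SET *
   (x @: [set~ inord 1] = [set x (inord 0); x (inord 2); x (inord 3)])%SET *
   (x @: [set~ inord 2] = [set x (inord 0); x (inord 1); x (inord 3)])%SET *
   (x @: [set~ inord 3] = [set x (inord 0); x (inord 1); x (inord 2)])%SET)%type.
Proof.
have C0 : ([set~ inord 0] = [set inord 1; inord 2; inord 3] :> {set 'I_4})%SET.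
  by apply/setP => -[[|[|[|[|//]]]] ?]; rewrite !inE -!val_eqE /= !inordK.
have C1 : ([set~ inord 1] = [set inord 0; inord 2; inord 3] :> {set 'I_4})%SET.
  by apply/setP => -[[|[|[|[|//]]]] ?]; rewrite !inE -!val_eqE /= !inordK.
have C2 : ([set~ inord 2] = [set inord 0; inord 1; inord 3] :> {set 'I_4})%SET.
  by apply/setP => -[[|[|[|[|//]]]] ?]; rewrite !inE -!val_eqE /= !inordK.
have C3 : ([set~ inord 3] = [set inord 0; inord 1; inord 2] :> {set 'I_4})%SET.
  by apply/setP => -[[|[|[|[|//]]]] ?]; rewrite !inE -!val_eqE /= !inordK.
by rewrite C0 C1 C2 C3 !imsetU !imset_set1.
Qed.

Lemma mem_K4minus i : ([set~ i]%SET \in edges K4minus) = (i != ord0).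
Proof.
rewrite !inE cardsC1 card_ord andbT; congr negb.
by apply/eqP/eqP => [/setC_inj/set1_inj|->].
Qed.

Section Isomorphism.
Variables (V : finType) (G : graph3 V) (x : 'I_4 -> V).
Hypothesis x_inj : injective x.
Let A := (x @: [set: 'I_4])%SET.
Let mem_x i : x i \in A. Proof. exact: imset_f. Qed.
Let y (i : 'I_4) : {v : V | v \in A} := exist _ (x i) (mem_x i).

Let y_inj : injective y.
Proof. by move=> i j /(congr1 val); exact: x_inj. Qed.

Let y_bij : bijective y.
Proof.
apply: inj_card_bij => //.
by rewrite card_sig card_ord (eq_card (B := A)) // card_imset // cardsT card_ord.
Qed.

Let mem_induced i :
  ((y @: [set~ i])%SET \in edges (induced G A)) = ((x @: [set~ i])%SET \in edges G).
Proof. by rewrite inE -imset_comp. Qed.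

(** A triple in a 4-set is determined by the vertex it omits, so with three edges present an
    isomorphism only has to match the vertices omitted by the two missing triples. *)
Lemma isomorphic_K4minusP :
  isomorphic (induced G A) K4minus <->
  #|[set i | (x @: [set~ i])%SET \in edges G]%SET| = 3.
Proof.
have [g gK yK] := y_bij; split=> [[f [f_bij fE]]|/card3_I4[i0 i0E]].
  have fy_inj : injective (f \o y) by apply: inj_comp => //; exact: bij_inj.
  have [h hK fyK] := injF_bij fy_inj.
  rewrite (_ : finset _ = [set~ h ord0]%SET) ?cardsC1 ?card_ord //.
  apply/setP => i; rewrite !inE -mem_induced fE -imset_comp imset_setC1 //.
  by rewrite mem_K4minus (can2_eq hK fyK).
(* The missing triple omits [i0] here and [ord0] in [K4minus]; the transposition matches them. *)
exists (tperm i0 ord0 \o g); split.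
  by apply: bij_comp; [exact: (Bijective (tpermK _ _) (tpermK _ _))|exists y].
move=> B; have [B3|B3] := eqVneq #|B| 3; last first.
  apply/idP/idP => /card_edge; first by move/eqP; rewrite (negPf B3).
  rewrite card_imset; last exact: inj_comp perm_inj (can_inj yK).
  by move/eqP; rewrite (negPf B3).
have /card3_I4[i Bi] : #|(g @: B)%SET| = 3.
  by rewrite card_imset //; exact: can_inj yK.
have -> : B = (y @: [set~ i])%SET.
  by rewrite -Bi -imset_comp (eq_imset (g := id)) ?imset_id // => v /=; rewrite yK.
rewrite mem_induced -imset_comp (eq_imset (g := tperm i0 ord0)); last first.
  by move=> j /=; rewrite gK.
rewrite imset_setC1 ?mem_K4minus; last exact: perm_inj.
have /setP/(_ i) := i0E; rewrite !inE => ->.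
by rewrite -[X in _ = (_ != X)](tpermL i0 ord0) (inj_eq perm_inj).
Qed.

End Isomorphism.

Section Counting.
Variables (V : finType) (G : graph3 V).

Definition adj (a b c : V) : bool := [set a; b; c]%SET \in edges G.

Lemma adj_swap12 a b c : adj a b c = adj b a c.
Proof. by rewrite /adj (setUC [set a])%SET. Qed.

Lemma adj_swap23 a b c : adj a b c = adj a c b.
Proof. by rewrite /adj setUAC. Qed.

Lemma adj_uniq a b c : adj a b c -> uniq [:: a; b; c].
Proof.
move=> /card_edge; rewrite -setUA cardsU1 cards2 !inE /= !inE andbT.
by case: (a == b) (a == c) (b == c) => [] [] [].
Qed.

Definition three_edges (a b c d : V) : bool :=
  adj a b c + adj a b d + adj a c d + adj b c d == 3.

(** The apex is the vertex outside the one missing triple, hence unique. *)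
Lemma three_edgesE a b c d : three_edges a b c d =
  apex adj a b c d + apex adj b a c d + apex adj c a b d + apex adj d a b c :> nat.
Proof.
rewrite /apex /three_edges !(adj_swap12 b a) !(adj_swap12 c a) !(adj_swap12 c b).
rewrite !(adj_swap12 d a) !(adj_swap12 d b) (adj_swap23 a c b) (adj_swap23 a d b).
rewrite (adj_swap23 a d c) (adj_swap23 b d c).
by case: (adj a b c) (adj a b d) (adj a c d) (adj b c d) => [] [] [] [].
Qed.

Lemma sum_three_edges :
  \sum_a \sum_b \sum_c \sum_d three_edges a b c d =
  4 * \sum_a \sum_b \sum_c \sum_d apex adj a b c d.
Proof.
under eq_bigr do under eq_bigr do under eq_bigr do under eq_bigr do rewrite three_edgesE.
under eq_bigr do under eq_bigr do under eq_bigr do rewrite !big_split /=.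
under eq_bigr do under eq_bigr do rewrite !big_split /=.
under eq_bigr do rewrite !big_split /=.
rewrite !big_split /=; set N := \sum_a _.
have -> : \sum_a \sum_b \sum_c \sum_d apex adj b a c d = N by rewrite exchange_big.
have -> : \sum_a \sum_b \sum_c \sum_d apex adj c a b d = N.
  by under eq_bigr do rewrite exchange_big; rewrite exchange_big.
have -> : \sum_a \sum_b \sum_c \sum_d apex adj d a b c = N; last by lia.
under eq_bigr => a _ do under eq_bigr => b _ do rewrite exchange_big /=.
by under eq_bigr do rewrite exchange_big; rewrite exchange_big.
Qed.

Lemma sum_ffun4 (F : V -> V -> V -> V -> nat) :
  \sum_(x : {ffun 'I_4 -> V}) F (x (inord 0)) (x (inord 1)) (x (inord 2)) (x (inord 3)) =
  \sum_a \sum_b \sum_c \sum_d F a b c d.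
Proof.
rewrite !pair_bigA /=.
pose list_of (u : V * V * V * V) := [:: u.1.1.1; u.1.1.2; u.1.2; u.2].
rewrite (reindex (fun u => [ffun i : 'I_4 => nth u.2 (list_of u) i])) /=.
  by apply: eq_bigr => -[[[a b] c] d] _; rewrite !ffunE !inordK.
exists (fun x => (x (inord 0), x (inord 1), x (inord 2), x (inord 3))).
  by move=> [[[a b] c] d] _; rewrite !ffunE !inordK.
move=> x _; apply/ffunP => i; rewrite ffunE /list_of /=.
case: i => [[|[|[|[|//]]]] i4] /=; congr (x _); apply: val_inj;
  by rewrite /= inordK.
Qed.

Lemma three_edges_ffun (x : {ffun 'I_4 -> V}) :
  three_edges (x (inord 0)) (x (inord 1)) (x (inord 2)) (x (inord 3)) =
  (#|[set i | (x @: [set~ i])%SET \in edges G]%SET| == 3).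
Proof.
rewrite /three_edges -sum1dep_card big_mkcond /=.
rewrite (eq_bigr (fun i : 'I_4 => nat_of_bool ((x @: [set~ inord i])%SET \in edges G)));
  last by move=> i _; rewrite inord_val; case: (_ \in _).
rewrite !big_ord_recl big_ord0 /= !/bump /= !add1n !imset_setC1_I4.
rewrite -/(adj _ _ _); congr (_ == 3); rewrite /adj; lia.
Qed.

Lemma three_edges_uniq a b c d : three_edges a b c d -> uniq [:: a; b; c; d].
Proof.
move: (@adj_uniq a b c) (@adj_uniq a b d) (@adj_uniq a c d) (@adj_uniq b c d).
rewrite /three_edges /= !inE.
case: (adj a b c) (adj a b d) (adj a c d) (adj b c d) => [] [] [] [] //;
by do ?[move=> /(_ isT)]; case: (a == b) (a == c) (a == d) (b == c) (b == d) (c == d)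
  => [] [] [] [] [] [] //=; do ?[move=> /(_ isT)].
Qed.

Lemma three_edges_inj (x : {ffun 'I_4 -> V}) :
  three_edges (x (inord 0)) (x (inord 1)) (x (inord 2)) (x (inord 3)) -> injective x.
Proof.
move=> /three_edges_uniq U; apply/injectiveP; rewrite /injectiveb /dinjectiveb.
rewrite (_ : enum 'I_4 = [seq inord k | k <- iota 0 4]) //.
by apply: (inj_map val_inj); rewrite val_enum_ord -map_comp /= !inordK.
Qed.

(** Maps from ['I_4] spanning three edges are injective. Grouped by image, each induced copy arises
    from all 4! = 24 bijections onto it. *)
Lemma count_induced_K4minus :
  24 * count_induced K4minus G = \sum_a \sum_b \sum_c \sum_d three_edges a b c d.
Proof.
(* A boolean summand is convertible to a conditional between 1 and 0, so it can become the filter of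
   the sum. *)
rewrite -sum_ffun4 /count_induced -big_mkcond /=.
rewrite (partition_big (fun x : {ffun 'I_4 -> V} => x @: [set: 'I_4])%SET
  (fun A : {set V} => A \in
    [set A : {set V} | (#|A| == #|'I_4|) && `[< isomorphic (induced G A) K4minus >]]%SET)) /=.
  rewrite mulnC -sum_nat_const; apply: eq_bigr => A.
  rewrite inE card_ord => /andP[/eqP A4 /asboolP A_iso].
  have <- : #|[set f : {ffun 'I_4 -> V} in ffun_on [in A] | injectiveb f]%SET| = 24.
    by rewrite card_inj_ffuns_on card_ord A4.
  rewrite sum1dep_card; apply: eq_card => x; rewrite !inE; symmetry.
  apply/andP/andP => [[x3 /eqP xA]|[/ffun_onP xA /injectiveP x_inj]].
    split; last exact/injectiveP/three_edges_inj.
    by apply/ffun_onP => i; rewrite -xA imset_f.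
  have xE : (x @: [set: 'I_4])%SET = A.
    apply/eqP; rewrite eqEcard card_imset // cardsT card_ord A4 leqnn andbT.
    by apply/subsetP => _ /imsetP[i _ ->].
  split; last exact/eqP.
  by rewrite three_edges_ffun; apply/eqP/isomorphic_K4minusP; rewrite ?xE.
move=> x x3; have x_inj := three_edges_inj x3.
rewrite inE card_imset // cardsT eqxx /=; apply/asboolP/isomorphic_K4minusP => //.
by apply/eqP; rewrite -three_edges_ffun.
Qed.

End Counting.

(** Repeated vertices are included: any two of the four lie in a common triple, and an edge has
    three distinct vertices. *)
Lemma free_K4 (V : finType) (G : graph3 V) : Defs.free (single3 K4) G ->
  forall a b c d, ~~ [&& adj G a b c, adj G a b d, adj G a c d & adj G b c d].
Proof.
move=> GK4 a b c d; apply/negP => /and4P[abc abd acd bcd].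
have U : uniq [:: a; b; c; d].
  move: (adj_uniq abc) (adj_uniq acd) (adj_uniq bcd) (adj_uniq abd); rewrite /= !inE.
  by case: (a == b) (a == c) (a == d) (b == c) (b == d) (c == d)
    => [] [] [] [] [] [].
apply: (GK4 4 K4 erefl).
have f_inj : injective (fun i : 'I_4 => nth a [:: a; b; c; d] i).
  by move=> i j /eqP; rewrite nth_uniq // => /eqP/val_inj.
exists (fun i : 'I_4 => nth a [:: a; b; c; d] i); split=> // B.
rewrite inE => /eqP/card3_I4[i ->]; rewrite -(inord_val i).
by case: i => [[|[|[|[|//]]]] ?] /=; rewrite imset_setC1_I4 !inordK.
Qed.

(** * Turan's construction *)

Section TuranGraph.
Variable n : nat.

Definition weight (v : nat) : nat := 4 ^ (v %% 3).

(* With the three parts A, B, C weighted 1, 4, 16, the four sums are those of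
   AAB, BBC, CCA and ABC. *)
Definition turan_sum (k : nat) : bool := k \in [:: 6; 24; 33; 21].

Definition turan_edges : {set {set 'I_n}} :=
  [set A : {set 'I_n} | (#|A| == 3) && turan_sum (\sum_(v in A) weight v)]%SET.

Lemma turan_edges3 : [forall A in turan_edges, #|A| == 3].
Proof. by apply/forall_inP => A; rewrite inE => /andP[]. Qed.

Definition turan_graph : graph3 'I_n := Graph3 turan_edges3.

Lemma adj_turan a b c : adj turan_graph a b c =
  uniq [:: a; b; c] && turan_sum (weight a + weight b + weight c).
Proof.
rewrite /adj inE -setUA; have [U|nU] := boolP (uniq [:: a; b; c]).
  move: U; rewrite /= !inE negb_or andbT => /andP[/andP[ab ac] bc].
  rewrite !big_setU1 ?inE ?negb_or ?ab ?ac //= big_set1 addnA.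
  by rewrite !cardsU1 !inE negb_or ab ac bc cards1.
rewrite (_ : _ == 3 = false) //; apply: contraNF nU => /eqP.
rewrite cardsU1 cards2 !inE /= !inE andbT.
by case: (a == b) (a == c) (b == c) => [] [] [].
Qed.

Lemma weightP v : weight v \in [:: 1; 4; 16].
Proof.
by have := ltn_pmod v (isT : 0 < 3); rewrite /weight; case: (v %% 3) => [|[|[|//]]].
Qed.

(** Only the parts of the four vertices matter, which leaves 81 cases. *)
Lemma turan_K4free (a b c d : 'I_n) : ~~ [&& turan_sum (weight a + weight b + weight c),
  turan_sum (weight a + weight b + weight d), turan_sum (weight a + weight c + weight d)
  & turan_sum (weight b + weight c + weight d)].
Proof.
have := weightP d; have := weightP c; have := weightP b; have := weightP a.
by rewrite !inE => /or3P[] /eqP-> /or3P[] /eqP-> /or3P[] /eqP-> /or3P[] /eqP->.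
Qed.

Lemma turan_graph_free : Defs.free (single3 K4) turan_graph.
Proof.
(* Stating the goal through the dependent pair allows rewriting with [eqH], an equality of such
   pairs. *)
move=> k H eqH; suff : ~ contains turan_graph (projT2 (existT (fun k => graph3 'I_k) k H)).
  by [].
rewrite (eqH : _ = _) /= => -[f [_ fE]].
have fC i : (f @: [set~ i])%SET \in edges turan_graph.
  by apply: fE; rewrite inE cardsC1 card_ord.
have := turan_K4free (f (inord 0)) (f (inord 1)) (f (inord 2)) (f (inord 3)).
move/negP; apply; apply/and4P.
move: (fC (inord 3)) (fC (inord 2)) (fC (inord 1)) (fC (inord 0)).
rewrite !imset_setC1_I4 -!/(adj _ _ _ _) !adj_turan.
by move=> /andP[_ ?] /andP[_ ?] /andP[_ ?] /andP[_ ?].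
Qed.

Definition turan_three (a b c d : nat) : bool :=
  turan_sum (4 ^ a + 4 ^ b + 4 ^ c) + turan_sum (4 ^ a + 4 ^ b + 4 ^ d) +
  turan_sum (4 ^ a + 4 ^ c + 4 ^ d) + turan_sum (4 ^ b + 4 ^ c + 4 ^ d) == 3.

(** Out of 81 patterns of parts; 48 / 81 = 16 / 27 is the limiting density. *)
Lemma sum_turan_three :
  \sum_(a < 3) \sum_(b < 3) \sum_(c < 3) \sum_(d < 3) turan_three a b c d = 48.
Proof. by rewrite !big_ord_recl !big_ord0. Qed.

(** The first 3m indices form m full periods, and the other terms are dropped. *)
Lemma sum_mod3_ge m (F : nat -> nat) :
  3 * m <= n -> m * \sum_(r < 3) F r <= \sum_(a < n) F (a %% 3).
Proof.
move=> mn; rewrite -(big_mkord xpredT (fun a => F (a %% 3))).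
rewrite (@big_cat_nat _ _ _ (3 * m)) //=.
apply: leq_trans (leq_addr _ _); elim: m {mn} => [//|m IHm].
have -> : 3 * m.+1 = (3 * m).+3 by lia.
rewrite !big_nat_recr //= !big_ord_recl big_ord0 /= in IHm *.
have m0 : (3 * m) %% 3 = 0 by rewrite modnMr.
have m1 : (3 * m).+1 %% 3 = 1 by rewrite -addn1 mulnC modnMDl.
have m2 : (3 * m).+2 %% 3 = 2 by rewrite -addn2 mulnC modnMDl.
rewrite m0 m1 m2 -[bump 0 (bump 0 0)]/2 -[bump 0 0]/1 in IHm *; lia.
Qed.

(** [turan_three] sees only residues and may hold where vertices repeat; any such tuple is paid for
    by at least one coincidence. *)
Lemma turan_three_edges (a b c d : 'I_n) :
  turan_three (a %% 3) (b %% 3) (c %% 3) (d %% 3) <=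
  three_edges turan_graph a b c d +
  ((a == b) + (a == c) + (a == d) + (b == c) + (b == d) + (c == d)).
Proof.
set k := (X in _ + X); have [k0|k_gt0] := posnP k; last first.
  exact: leq_trans (leq_b1 _) (leq_trans k_gt0 (leq_addl _ _)).
rewrite k0 addn0 /three_edges !adj_turan /= !inE.
move: k0; rewrite /k; case: (a == b) (a == c) (a == d) => [] [] [] //=.
by case: (b == c) (b == d) (c == d) => [] [] [].
Qed.

Lemma sum_eq1 (a : 'I_n) : \sum_(b < n) (a == b) = 1.
Proof. by rewrite (bigD1 a) //= eqxx big1 // => b /negPf; rewrite eq_sym => ->. Qed.

Lemma sum_turan_three_ge : 48 * (n %/ 3) ^ 4 <=
  \sum_(a < n) \sum_(b < n) \sum_(c < n) \sum_(d < n)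
    turan_three (a %% 3) (b %% 3) (c %% 3) (d %% 3).
Proof.
set m := n %/ 3; have mn : 3 * m <= n by rewrite mulnC leq_divM.
have ge F := @sum_mod3_ge m F mn.
rewrite -sum_turan_three !expnS expn0 muln1 mulnC -!mulnA.
apply: leq_trans (ge (fun a => \sum_(b < n) \sum_(c < n) \sum_(d < n)
  turan_three a (b %% 3) (c %% 3) (d %% 3))).
rewrite leq_mul2l !big_distrr leq_sum ?orbT //= => a _.
apply: leq_trans (ge (fun b => \sum_(c < n) \sum_(d < n)
  turan_three a b (c %% 3) (d %% 3))).
rewrite leq_mul2l !big_distrr leq_sum ?orbT //= => b _.
apply: leq_trans (ge (fun c => \sum_(d < n) turan_three a b c (d %% 3))).
rewrite leq_mul2l !big_distrr leq_sum ?orbT //= => c _.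
exact: (ge (fun d => turan_three a b c d)).
Qed.

(** Each of the six pairs coincides in n^3 of the n^4 tuples. *)
Lemma sum_coincidences :
  \sum_(a < n) \sum_(b < n) \sum_(c < n) \sum_(d < n)
  ((a == b) + (a == c) + (a == d) + (b == c) + (b == d) + (c == d)) = 6 * n ^ 3.
Proof.
have const k : \sum_(b < n) k = n * k by rewrite sum_nat_const card_ord.
transitivity (\sum_(a < n) (6 * n ^ 2)); last by rewrite const; lia.
apply: eq_bigr => a _.
transitivity (\sum_(b < n) (n * (n * (a == b) + 2) + 3 * n)); last first.
  by rewrite big_split /= -big_distrr /= big_split /= -big_distrr /= sum_eq1 !const; lia.
apply: eq_bigr => b _.
transitivity (\sum_(c < n) (n * ((a == b) + (a == c) + (b == c)) + 3)); last first.
  rewrite big_split /= -big_distrr /= !big_split /= !sum_eq1 !const; lia.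
apply: eq_bigr => c _.
rewrite !big_split /= !sum_eq1 !const !mulnDr.
by move: (n * (a == b)) (n * (a == c)) (n * (b == c)) => u v w; lia.
Qed.

Lemma turan_graph_count :
  48 * (n %/ 3) ^ 4 <= 24 * count_induced K4minus turan_graph + 6 * n ^ 3.
Proof.
apply: leq_trans sum_turan_three_ge _; rewrite count_induced_K4minus -sum_coincidences.
rewrite -big_split leq_sum //= => a _; rewrite -big_split leq_sum //= => b _.
rewrite -big_split leq_sum //= => c _; rewrite -big_split leq_sum //= => d _.
exact: turan_three_edges.
Qed.

End TuranGraph.

Lemma turan_ex_ge n : 48 * (n %/ 3) ^ 4 <= 24 * turan_ex K4minus n (single3 K4) + 6 * n ^ 3.
Proof.
apply: leq_trans (turan_graph_count n) _; rewrite leq_add2r leq_pmul2l //.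
rewrite /turan_ex (bigD1 (turan_graph n)) /= ?leq_maxl //.
exact/asboolP/turan_graph_free.
Qed.

(** For the apex count N and the number t of copies, 24 t = 4 N and 27 N <= 4 n^4. The quotient by
    81 leaves the maximum alone on the left, as [bigmax_leqP] requires. *)
Lemma turan_ex_le n : 81 * turan_ex K4minus n (single3 K4) <= 2 * n ^ 4.
Proof.
suff: turan_ex K4minus n (single3 K4) <= (2 * n ^ 4) %/ 81.
  by rewrite leq_divRL // mulnC.
apply/bigmax_leqP => G /asboolP/free_K4 GK4; rewrite leq_divRL //.
have := apex_bound (@adj_swap12 _ G) (@adj_swap23 _ G) GK4.
by have := count_induced_K4minus G; rewrite sum_three_edges card_ord; lia.
Qed.

(** * The limit *)

From mathcomp Require Import all_classical all_reals all_analysis.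
Import numFieldNormedType.Exports.

Local Open Scope ring_scope.

Lemma bin4E (R : realType) (n : nat) : (3 <= n)%N ->
  ('C(n, 4))%:R * 24 = n%:R * (n%:R - 1) * (n%:R - 2) * (n%:R - 3) :> R.
Proof.
move=> n3; rewrite -[24 : R]/(4`!)%:R -natrM bin_ffact.
case: n n3 => [|[|[|n]]] // _.
rewrite !ffactnS ffactn0 /= muln1 !natrM -!natr1; ring.
Qed.

(** Coincidences, rounding in [n %/ 3], and the gap between n^4 and 24 ['C(n, 4)] cost only O(n^3),
    which 11 / n times the binomial absorbs once n is at least 20. *)
Lemma density_bounds (R : realType) (n : nat) : (20 <= n)%N ->
  `|(turan_ex K4minus n (single3 K4))%:R / ('C(n, #|'I_4|))%:R - 16 / 27 : R| <= 11 / n%:R.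
Proof.
move=> n20; rewrite card_ord.
have n_ge20 : 20 <= n%:R :> R by rewrite (ler_nat R 20 n).
have C4 := bin4E R (leq_trans (isT : (3 <= 20)%N) n20).
have ub : 81 * (turan_ex K4minus n (single3 K4))%:R <= 2 * n%:R ^+ 4 :> R.
  by rewrite -natrX -!natrM ler_nat; exact: turan_ex_le.
have lb : 48 * (n %/ 3)%:R ^+ 4 <=
    24 * (turan_ex K4minus n (single3 K4))%:R + 6 * n%:R ^+ 3 :> R.
  by rewrite -!natrX -!natrM -natrD ler_nat; exact: turan_ex_ge.
have m_ge : n%:R - 2 <= 3 * (n %/ 3)%:R :> R.
  rewrite lerBlDr -natrM -natrD ler_nat {1}(divn_eq n 3) mulnC leq_add2l.
  by rewrite -ltnS ltn_pmod.
move: lb ub C4 m_ge; move: (turan_ex _ _ _)%:R ('C(n, 4))%:R (n %/ 3)%:R => t C m.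
move: n_ge20; move: (n%:R : R) => x x20 lb ub C4 m_ge.
have m4 : (x - 2) ^+ 4 <= 81 * m ^+ 4.
  have -> : 81 * m ^+ 4 = (3 * m) ^+ 4 by ring.
  by rewrite ler_pXn2r // nnegrE; lra.
(* These two products are hints for the final calls of [nra]. *)
have x2 : 0 <= x * (x - 20) by nra.
have x3 : 0 <= x ^+ 2 * (x - 20) by nra.
(* As x p = 24 C, the quotient C / x is the polynomial p / 24, and both goals become polynomial
   inequalities. *)
pose p := (x - 1) * (x - 2) * (x - 3).
have xp : x * p = C * 24 by rewrite C4 /p; ring.
have p_gt0 : 0 < p by rewrite /p !mulr_gt0 //; lra.
have x_gt0 : 0 < x by lra.
have C_gt0 : 0 < C by nra.
have CE : C = x * p / 24 by rewrite xp; field.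
have Cx : C / x = p / 24 by rewrite CE; field; rewrite gt_eqF.
rewrite ler_distl ler_pdivlMr // ler_pdivrMr //; apply/andP; split.
  have -> : (16 / 27 - 11 / x) * C = 16 / 27 * C - 11 * (C / x) by ring.
  by rewrite Cx CE /p; nra.
have -> : (16 / 27 + 11 / x) * C = 16 / 27 * C + 11 * (C / x) by ring.
by rewrite Cx CE /p; nra.
Qed.

Lemma density_cvg (R : realType) :
  ((fun n : nat => (turan_ex K4minus n (single3 K4))%:R / ('C(n, #|'I_4|))%:R : R)
    @ \oo --> (16 / 27 : R))%classic.
Proof.
have c11 : ((fun n : nat => 11 / n%:R : R) @ \oo --> (0 : R))%classic.
  rewrite -[X in (_ --> X)%classic](mulr0 11); apply: cvgMr.
  by apply/gtr0_cvgV0; [near=> n; rewrite ltr0n; near: n; exact: nbhs_infty_gt|exact: cvgr_idn].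
apply: (@squeeze_cvgr _ _ _ _ (fun n : nat => 16 / 27 - 11 / n%:R)
          (fun n : nat => 16 / 27 + 11 / n%:R)).
- near=> n; rewrite -ler_distl; apply: density_bounds.
  by near: n; exact: nbhs_infty_ge.
- by rewrite -[X in (_ --> X)%classic]subr0; apply: cvgB => //; exact: cvg_cst.
- by rewrite -[X in (_ --> X)%classic]addr0; apply: cvgD => //; exact: cvg_cst.
Unshelve. all: by end_near.
Qed.

Theorem theorem2p3 (R : realType) :
  turan_density R K4minus (single3 K4) = 16 / 27.
Proof. exact: cvg_lim (@density_cvg R). Qed.
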